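(* Let $k$ be a field, let $H$ be a Hopf algebra over $k$, and let $A$ be a right $H$-comodule algebra with subalgebra of coinvariants $B=A^{co(H)}$. Suppose that $B\subset A$ is an $H$-Galois extension and that $A$ is separable over $B$. Then $H$ is finite dimensional over $k$.
   Context: All vector spaces and algebras are over the field $k$, and $\otimes$ denotes the tensor product over $k$. Algebras are associative and unital, and are not assumed commutative. A Hopf algebra is a bialgebra with an antipode; the antipode is not assumed bijective. A right $H$-comodule algebra is a $k$-algebra $A$ with a right $H$-comodule structure $\rho:A\to A\otimes H$, $\rho(a)=\sum_{(a)} a_{(0)}\otimes a_{(1)}$, such that $\rho$ is an algebra homomorphism. Its subalgebra of coinvariants is $A^{co(H)}=\{a\in A:\rho(a)=a\otimes 1_H\}$, denoted $B$. The extension $B\subset A$ is called (right) $H$-Galois if the map $$can:A\otimes_B A\to A\otimes H,\qquad a\otimes_B a'\mapsto \sum_{(a')} a\,a'_{(0)}\otimes a'_{(1)}$$ is an isomorphism (i.e. bijective). $A$ is separable over $B$ if there is a separability idempotent, i.e. an element $e=\sum_{i=1}^n e_i\otimes_B e'_i\in A\otimes_B A$ such that $\sum_{i=1}^n e_ie'_i=1_A$ and $ae=ea$ for all $a\in A$, where $A\otimes_B A$ has the $A$-bimodule structure $a(x\otimes_B y)a'=ax\otimes_B ya'$.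
   Formalization: The comodule algebra A is assumed nonzero; for A = 0 the extension is trivially H-Galois and separable for every Hopf algebra H (for example H = k[x]), so the claim fails there. *)

(* Defs.v *)
From HB Require Import structures.
From mathcomp Require Import all_boot all_order all_algebra.
From mathcomp Require Import boolp.
From mathcomp Require Import freeg.

Set Implicit Arguments.
Unset Strict Implicit.
Unset Printing Implicit Defensive.

Import GRing.Theory.
Local Open Scope ring_scope.
Local Open Scope quotient_scope.

Reserved Notation "U ⊗ V" (at level 40, left associativity).

(* [S] plays the role of the scalars, acting on the right of [M] by [ra] and on
   the left of [N] by [la].  When [S] is a ring and [ra], [la] are module
   structures, [btensor ra la] is the abelian group usually written M ⊗_S N:
   the free abelian group on [M * N] modulo the subgroup [brel] generated by
   the usual relations. *)
Section BalancedTensor.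
Variables (S : Type) (M N : zmodType) (ra : S -> M -> M) (la : S -> N -> N).

Inductive brel : {freeg (M * N) / int} -> Prop :=
| brel0 : brel 0
| brelB x y : brel x -> brel y -> brel (x - y)
| brelDl m m' n : brel (<< (m + m', n) >> - (<< (m, n) >> + << (m', n) >>))
| brelDr m n n' : brel (<< (m, n + n') >> - (<< (m, n) >> + << (m, n') >>))
| brelS s m n : brel (<< (ra s m, n) >> - << (m, la s n) >>).

Definition brel_pred : {pred {freeg (M * N) / int}} := [pred x | `[< brel x >]].

Lemma brel_zmod_closed : zmod_closed brel_pred.
Proof.
split; first exact/asboolP/brel0.
by move=> x y /asboolP hx /asboolP hy; exact/asboolP/brelB.
Qed.

HB.instance Definition _ :=
  GRing.isZmodClosed.Build {freeg (M * N) / int} brel_pred brel_zmod_closed.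

Definition btensor : Type := Quotient.quot brel_pred.

HB.instance Definition _ := GRing.Zmodule.on btensor.

Definition bpure (m : M) (n : N) : btensor := \pi_btensor << (m, n) >>.

(* The homomorphism [m ⊗ n |-> f m n].  It is computed on a representative, so
   it is meaningful only for a [balanced] f, see [bliftE] and [blift_zmod]. *)
Definition blift (W : zmodType) (f : M -> N -> W) (t : btensor) : W :=
  fglift (fun p => f p.1 p.2 : zmodule W) (repr t).

Record balanced (W : zmodType) (f : M -> N -> W) : Prop := Balanced {
  balDl : forall m m' n, f (m + m') n = f m n + f m' n;
  balDr : forall m n n', f m (n + n') = f m n + f m n';
  balS : forall s m n, f (ra s m) n = f m (la s n) }.

Lemma bpi_eq x y : brel (x - y) -> \pi_btensor x = \pi_btensor y.
Proof.
move=> h; apply/eqmodP; rewrite /= /Quotient.equiv; exact/asboolP.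
Qed.

Lemma bpureDl m m' n : bpure (m + m') n = bpure m n + bpure m' n.
Proof. by rewrite /bpure -raddfD; apply: bpi_eq; exact: brelDl. Qed.

Lemma bpureDr m n n' : bpure m (n + n') = bpure m n + bpure m n'.
Proof. by rewrite /bpure -raddfD; apply: bpi_eq; exact: brelDr. Qed.

Lemma bpureS s m n : bpure (ra s m) n = bpure m (la s n).
Proof. by apply: bpi_eq; exact: brelS. Qed.

Lemma bpure_balanced : balanced bpure.
Proof. split; [exact: bpureDl | exact: bpureDr | exact: bpureS]. Qed.

Section Lift.
Variables (W : zmodType) (f : M -> N -> W) (bf : balanced f).
Let F : {freeg (M * N) / int} -> zmodule W := fglift (fun p => f p.1 p.2 : zmodule W).

Let FB x y : F (x - y) = F x - F y. Proof. exact: lift_is_additive. Qed.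

Let F0 : F 0 = 0. Proof. by rewrite -[0 in LHS](subrr 0) FB subrr. Qed.

Let FD x y : F (x + y) = F x + F y.
Proof. by rewrite -[y in LHS]opprK -[- y]sub0r !FB F0 sub0r opprK. Qed.

Let FU m n : F << (m, n) >> = f m n.
Proof. by rewrite /F liftU scale1r. Qed.

Let F_brel x : brel x -> F x = 0.
Proof.
elim=> [|{}x y _ hx _ hy|m m' n|m n n'|s m n].
- exact: F0.
- by rewrite FB hx hy subr0.
- by rewrite FB FD !FU (balDl bf); apply: subrr.
- by rewrite FB FD !FU (balDr bf); apply: subrr.
- by rewrite FB !FU (balS bf); apply: subrr.
Qed.

Let blift_pi x : blift f (\pi_btensor x) = F x.
Proof.
apply/eqP; rewrite /blift -/(F _) -subr_eq0 -FB F_brel //.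
apply/asboolP; have : repr (\pi_btensor x) = x %[mod btensor] by rewrite reprK.
by move/eqmodP; rewrite /= /Quotient.equiv.
Qed.

Lemma bliftE m n : blift f (bpure m n) = f m n.
Proof. by rewrite blift_pi FU. Qed.

Lemma blift_zmod : zmod_morphism (blift f).
Proof.
move=> s t; rewrite -[s]reprK -[t]reprK -raddfB !blift_pi; exact: FB.
Qed.

End Lift.

Lemma btensor_ind (P : btensor -> Prop) :
  (forall s t, P s -> P t -> P (s - t)) -> (forall m n, P (bpure m n)) ->
  forall t, P t.
Proof.
move=> PB Pp; have P0 : P 0 by rewrite -(subrr (bpure 0 0)); exact: PB.
have PN t : P t -> P (- t) by rewrite -[- t]sub0r; exact: PB.
have PD s t : P s -> P t -> P (s + t).
  by move=> Ps Pt; rewrite -[t]opprK; apply/PB/PN.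
move=> t; rewrite -[t]reprK -[repr t]freeg_sumE raddf_sum.
apply: big_ind => // -[m n] _; set c := coeff _ _.
have -> : << c *g (m, n) >> = << (m, n) >> *~ c.
  by rewrite freegU_mulz intz.
have Pn j : P (bpure m n *+ j).
  by elim: j => [|j IH]; [rewrite mulr0n | rewrite mulrS; exact: PD].
rewrite raddfMz -/(bpure m n); case: c => c; first by rewrite -pmulrn.
by rewrite NegzE mulrNz -pmulrn; exact: PN.
Qed.

End BalancedTensor.

Section Tensor.
Variable k : fieldType.

Definition tensor (U V : lmodType k) : Type :=
  btensor (fun (c : k) (u : U) => c *: u) (fun (c : k) (v : V) => c *: v).

Implicit Types U V W : lmodType k.

HB.instance Definition _ U V := GRing.Zmodule.on (tensor U V).

Definition pure U V (u : U) (v : V) : tensor U V := bpure _ _ u v.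

Definition tlift U V (W : zmodType) (f : U -> V -> W) : tensor U V -> W :=
  blift f.

Definition tbalanced U V (W : zmodType) (f : U -> V -> W) : Prop :=
  balanced (fun (c : k) (u : U) => c *: u) (fun (c : k) (v : V) => c *: v) f.

Lemma pureDl U V (u u' : U) (v : V) : pure (u + u') v = pure u v + pure u' v.
Proof. exact: bpureDl. Qed.

Lemma pureDr U V (u : U) (v v' : V) : pure u (v + v') = pure u v + pure u v'.
Proof. exact: bpureDr. Qed.

Lemma pureZlr U V c (u : U) (v : V) : pure (c *: u) v = pure u (c *: v).
Proof. exact: bpureS. Qed.

Lemma tensor_ind U V (P : tensor U V -> Prop) :
  (forall s t, P s -> P t -> P (s - t)) -> (forall u v, P (pure u v)) ->
  forall t, P t.
Proof. exact: btensor_ind. Qed.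

Lemma tensor_ext U V (W : zmodType) (f g : tensor U V -> W) :
  zmod_morphism f -> zmod_morphism g ->
  (forall u v, f (pure u v) = g (pure u v)) -> f =1 g.
Proof. by move=> fB gB fg; elim/tensor_ind=> // s t; rewrite fB gB => -> ->. Qed.

Section TLift.
Variables (U V : lmodType k) (W : zmodType) (f : U -> V -> W).
Hypothesis bf : tbalanced f.

Lemma tliftE u v : tlift f (pure u v) = f u v.
Proof. exact: bliftE. Qed.

Lemma tliftB : zmod_morphism (tlift f).
Proof. exact: blift_zmod. Qed.

Lemma tliftD : {morph tlift f : s t / s + t}.
Proof.
have tlift0 : tlift f 0 = 0.
  by have := tliftB 0 0; rewrite !subrr.
move=> s t; rewrite -[t in LHS]opprK -[- t]sub0r !tliftB.
by rewrite tlift0 sub0r opprK.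
Qed.

End TLift.

Definition tscale U V (c : k) : tensor U V -> tensor U V :=
  tlift (fun u v => pure (c *: u) v).

Lemma tscale_balanced U V c :
  tbalanced (fun (u : U) (v : V) => pure (c *: u) v).
Proof.
split=> [u u' v|u v v'|d u v]; first by rewrite scalerDr pureDl.
  by rewrite pureDr.
by rewrite scalerA mulrC -scalerA pureZlr.
Qed.

Lemma tscaleE U V c (u : U) (v : V) : tscale c (pure u v) = pure (c *: u) v.
Proof. exact/tliftE/tscale_balanced. Qed.

Lemma tscaleDr U V : right_distributive (@tscale U V) +%R.
Proof. by move=> c; exact/tliftD/tscale_balanced. Qed.

Lemma tscaleB U V c : zmod_morphism (@tscale U V c).
Proof. exact/tliftB/tscale_balanced. Qed.

Lemma tscaleA U V c d (t : tensor U V) :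
  tscale c (tscale d t) = tscale (c * d) t.
Proof.
elim/tensor_ind: t => [s t IHs IHt|u v]; first by rewrite !tscaleB IHs IHt.
by rewrite !tscaleE scalerA.
Qed.

Lemma tscale1 U V : left_id 1 (@tscale U V).
Proof.
elim/tensor_ind=> [s t IHs IHt|u v]; first by rewrite !tscaleB IHs IHt.
by rewrite !tscaleE scale1r.
Qed.

Lemma tscaleDl U V (t : tensor U V) : {morph (@tscale U V)^~ t : c d / c + d}.
Proof.
move=> c d; elim/tensor_ind: t => [s t IHs IHt|u v].
  by rewrite !tscaleB IHs IHt opprD addrACA.
by rewrite !tscaleE scalerDl pureDl.
Qed.

HB.instance Definition _ U V := GRing.Zmodule_isLmodule.Build k (tensor U V)
  (@tscaleA U V) (@tscale1 U V) (@tscaleDr U V) (@tscaleDl U V).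

Lemma pureZl U V c (u : U) (v : V) : pure (c *: u) v = c *: pure u v.
Proof. by rewrite -tscaleE. Qed.

Lemma pureZr U V c (u : U) (v : V) : pure u (c *: v) = c *: pure u v.
Proof. by rewrite -pureZlr pureZl. Qed.

Lemma tliftZ U V W (f : U -> V -> W) : tbalanced f ->
    (forall c u v, f (c *: u) v = c *: f u v) ->
  forall c t, tlift f (c *: t) = c *: tlift f t.
Proof.
move=> bf fZ c; elim/tensor_ind=> [s t IHs IHt|u v].
  by rewrite scalerBr !tliftB // IHs IHt scalerBr.
by rewrite -pureZl !tliftE.
Qed.

(* The map f ⊗ g, meaningful only for linear [f] and [g], see [tmapE]. *)
Definition tmap U V U' V' (f : U -> U') (g : V -> V') :
  tensor U V -> tensor U' V' := tlift (fun u v => pure (f u) (g v)).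

Lemma tmap_balanced U V U' V' (f : {linear U -> U'}) (g : {linear V -> V'}) :
  tbalanced (fun u v => pure (f u) (g v)).
Proof.
split=> [u u' v|u v v'|c u v].
- by rewrite raddfD pureDl.
- by rewrite raddfD pureDr.
- by rewrite !linearZ pureZlr.
Qed.

Lemma tmap_linear U V U' V' (f : {linear U -> U'}) (g : {linear V -> V'}) :
  linear (tmap f g).
Proof.
move=> c s t; rewrite /tmap tliftD ?tliftZ //; try exact: tmap_balanced.
by move=> d u v; rewrite linearZ pureZl.
Qed.

HB.instance Definition _ U V U' V' (f : {linear U -> U'}) (g : {linear V -> V'})
  := GRing.isLinear.Build k (tensor U V) (tensor U' V') _ (tmap f g)
       (tmap_linear f g).

Lemma tmapE U V U' V' (f : {linear U -> U'}) (g : {linear V -> V'}) u v :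
  tmap f g (pure u v) = pure (f u) (g v).
Proof. exact/tliftE/tmap_balanced. Qed.

Definition tassoc U V W : tensor (tensor U V) W -> tensor U (tensor V W) :=
  tlift (fun t w => tlift (fun u v => pure u (pure v w)) t).

Lemma tassocE U V W (u : U) (v : V) (w : W) :
  tassoc (pure (pure u v) w) = pure u (pure v w).
Proof.
have b w' : tbalanced (fun (u : U) (v : V) => pure u (pure v (w' : W))).
  split=> [x x' y|x y y'|c x y]; first by rewrite pureDl.
    by rewrite pureDl pureDr.
  by rewrite pureZlr pureZl.
rewrite /tassoc tliftE ?tliftE //; split=> [s t w'|s w1 w2|c s w'].
- exact: tliftD.
- elim/tensor_ind: s => [s t IHs IHt|x y].
    by rewrite !tliftB // IHs IHt opprD addrACA.
  by rewrite !tliftE // !pureDr.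
- elim/tensor_ind: s => [s t IHs IHt|x y].
    by rewrite scalerBr !tliftB // IHs IHt.
  by rewrite -pureZl !tliftE // pureZlr -!pureZr.
Qed.

End Tensor.

Arguments tassoc {k U V W} t.

Notation "U ⊗ V" := (tensor U V) : type_scope.
Notation "u ⊗ v" := (pure u v) : ring_scope.

(* Only a [pzRingType] structure is put on A ⊗ C: proving 1 != 0 there would
   need bases of possibly infinite-dimensional spaces. *)
Section TensorAlgebra.
Variables (k : fieldType) (A C : algType k).
Implicit Types s t : (A ⊗ C)%type.

Definition tmul s t : A ⊗ C :=
  tlift (fun a c => tlift (fun a' c' => (a * a') ⊗ (c * c')) t) s.

Let bal1 a c :
  tbalanced (fun (a' : A) (c' : C) => (a * a') ⊗ (c * c')).
Proof.
split=> [x y z|x y z|d x y].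
- by rewrite mulrDr pureDl.
- by rewrite mulrDr pureDr.
- by rewrite -!scalerAr pureZlr.
Qed.

Let bal2 t : tbalanced (fun (a : A) (c : C) =>
  tlift (fun (a' : A) (c' : C) => (a * a') ⊗ (c * c')) t).
Proof.
split=> [x y z|x y z|d x y]; elim/tensor_ind: t => [s t IHs IHt|a c].
- by rewrite !tliftB // IHs IHt opprD addrACA.
- by rewrite !tliftE // mulrDl pureDl.
- by rewrite !tliftB // IHs IHt opprD addrACA.
- by rewrite !tliftE // mulrDl pureDr.
- by rewrite !tliftB // IHs IHt.
- by rewrite !tliftE // -!scalerAl pureZlr.
Qed.

Lemma tmul_pure a c a' c' : tmul (a ⊗ c) (a' ⊗ c') = (a * a') ⊗ (c * c').
Proof. by rewrite /tmul !tliftE. Qed.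

Let tmulBl t : zmod_morphism (tmul^~ t).
Proof. exact: tliftB. Qed.

Let tmulBr s : zmod_morphism (tmul s).
Proof.
move=> t u; rewrite /tmul; elim/tensor_ind: s => [s s' IHs IHs'|a c].
  by rewrite !(tliftB (bal2 _)) IHs IHs' !opprD !opprK addrACA.
by rewrite !(tliftE (bal2 _)) (tliftB (bal1 _ _)).
Qed.

Let tmulA : associative tmul.
Proof.
move=> s t u.
elim/tensor_ind: s => [s s' IHs IHs'|a c]; first by rewrite !tmulBl IHs IHs'.
elim/tensor_ind: t => [t t' IHt IHt'|a' c'].
  by rewrite !(tmulBl, tmulBr) IHt IHt'.
elim/tensor_ind: u => [u u' IHu IHu'|b d]; first by rewrite !tmulBr IHu IHu'.
by rewrite !tmul_pure !mulrA.
Qed.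

Let tmul1l : left_id (1 ⊗ 1) tmul.
Proof.
elim/tensor_ind=> [s s' IHs IHs'|a c]; first by rewrite !tmulBr IHs IHs'.
by rewrite tmul_pure !mul1r.
Qed.

Let tmul1r : right_id (1 ⊗ 1) tmul.
Proof.
elim/tensor_ind=> [s s' IHs IHs'|a c]; first by rewrite !tmulBl IHs IHs'.
by rewrite tmul_pure !mulr1.
Qed.

Let tmulDl : left_distributive tmul +%R.
Proof. by move=> s t u; exact: (tliftD (bal2 _)). Qed.

Let tmulDr : right_distributive tmul +%R.
Proof.
move=> s t u; rewrite -[u in LHS]opprK tmulBr; congr (_ + _).
apply/eqP; rewrite eqr_oppLR -[- u]sub0r tmulBr.
by rewrite -(subrr 0) tmulBr subrr sub0r.
Qed.

HB.instance Definition _ := GRing.Zmodule_isPzRing.Build (A ⊗ C)%type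
  tmulA tmul1l tmul1r tmulDl tmulDr.

Lemma pureM (a a' : A) (c c' : C) : (a ⊗ c) * (a' ⊗ c') = (a * a') ⊗ (c * c').
Proof. exact: tmul_pure. Qed.

Lemma pure1 : 1 = 1 ⊗ 1 :> (A ⊗ C).
Proof. by []. Qed.

End TensorAlgebra.

(* In [counitl], [counitr] and [coact_counit] the canonical isomorphisms
   k ⊗ C ≅ C, C ⊗ k ≅ C and M ⊗ k ≅ M have been applied. *)
HB.mixin Record isCoalgebra (k : fieldType) C of GRing.Lmodule k C := {
  comul : {linear C -> (C ⊗ C)%type};
  counit : {linear C -> k^o};
  comulA : forall x : C,
    tassoc (tmap comul idfun (comul x)) = tmap idfun comul (comul x);
  counitl : forall x : C, tlift (fun y z : C => (counit y : k) *: z) (comul x) = x;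
  counitr : forall x : C, tlift (fun y z : C => (counit z : k) *: y) (comul x) = x
}.

#[short(type="coalgType")]
HB.structure Definition Coalgebra (k : fieldType) :=
  {C of isCoalgebra k C & GRing.Lmodule k C}.

HB.mixin Record isBialgebra (k : fieldType) H of GRing.Algebra k H
    & Coalgebra k H := {
  comul_monoid_morphism : monoid_morphism (comul : H -> (H ⊗ H)%type);
  counit_monoid_morphism : monoid_morphism (counit : H -> k)
}.

#[short(type="bialgType")]
HB.structure Definition Bialgebra (k : fieldType) :=
  {H of isBialgebra k H & GRing.Algebra k H & Coalgebra k H}.

HB.mixin Record isHopf (k : fieldType) H of Bialgebra k H := {
  antipode : {linear H -> H};
  antipodel : forall x : H,
    tlift (fun y z : H => antipode y * z) (comul x) = (counit x : k) *: 1;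
  antipoder : forall x : H,
    tlift (fun y z : H => y * antipode z) (comul x) = (counit x : k) *: 1
}.

#[short(type="hopfAlgType")]
HB.structure Definition HopfAlgebra (k : fieldType) :=
  {H of isHopf k H & Bialgebra k H}.

HB.mixin Record isComodule (k : fieldType) (C : coalgType k) M
    of GRing.Lmodule k M := {
  coact : {linear M -> (M ⊗ C)%type};
  coactA : forall x : M,
    tassoc (tmap coact idfun (coact x)) = tmap idfun comul (coact x);
  coact_counit : forall x : M, 
    tlift (fun (y : M) (c : C) => (counit c : k) *: y) (coact x) = x
}.

#[short(type="comodType")]
HB.structure Definition Comodule (k : fieldType) (C : coalgType k) :=
  {M of isComodule k C M & GRing.Lmodule k M}.

(* As an [algType], a comodule algebra is nonzero.  This matters: the zero
   algebra would be Galois and separable for every [H]. *)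
HB.mixin Record isComoduleAlgebra (k : fieldType) (H : bialgType k) A
    of GRing.Algebra k A & Comodule k H A := {
  coact_monoid_morphism : monoid_morphism (coact : A -> (A ⊗ H)%type)
}.

#[short(type="comodAlgType")]
HB.structure Definition ComoduleAlgebra (k : fieldType) (H : bialgType k) :=
  {A of isComoduleAlgebra k H A & GRing.Algebra k A & Comodule k H A}.

Section Separable.
Variables (k : fieldType) (A : algType k) (B : subalgClosed A).

(* A ⊗_B A *)
Definition tensor_over : Type :=
  btensor (fun (b : {b : A | b \in B}) (a : A) => a * val b)
          (fun (b : {b : A | b \in B}) (a : A) => val b * a).

HB.instance Definition _ := GRing.Zmodule.on tensor_over.

Definition pure_over (a a' : A) : tensor_over := bpure _ _ a a'.

Definition lact (a : A) (t : tensor_over) : tensor_over :=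
  blift (fun x y => pure_over (a * x) y) t.

Definition ract (t : tensor_over) (a : A) : tensor_over :=
  blift (fun x y => pure_over x (y * a)) t.

Let scalr (b : {b : A | b \in B}) (a : A) := a * val b.
Let scall (b : {b : A | b \in B}) (a : A) := val b * a.

Lemma lact_balanced a : balanced scalr scall (fun x y => pure_over (a * x) y).
Proof.
split=> [x1 x2 z|x z1 z2|b x z].
- by rewrite mulrDr; exact: bpureDl.
- exact: bpureDr.
- by rewrite mulrA; exact: bpureS.
Qed.

Lemma ract_balanced a : balanced scalr scall (fun x y => pure_over x (y * a)).
Proof.
split=> [x1 x2 z|x z1 z2|b x z].
- exact: bpureDl.
- by rewrite mulrDl; exact: bpureDr.
- by rewrite -mulrA; exact: bpureS.
Qed.

Lemma lactE a x y : lact a (pure_over x y) = pure_over (a * x) y.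
Proof. exact/bliftE/lact_balanced. Qed.

Lemma ractE a x y : ract (pure_over x y) a = pure_over x (y * a).
Proof. exact/bliftE/ract_balanced. Qed.

Lemma lact_zmod a : zmod_morphism (lact a).
Proof. exact/blift_zmod/lact_balanced. Qed.

Lemma ract_zmod a : zmod_morphism (ract^~ a).
Proof. exact/blift_zmod/ract_balanced. Qed.

Definition separable_over : Prop :=
  exists e : seq (A * A),
    let t : tensor_over := \sum_(p <- e) pure_over p.1 p.2 in
    \sum_(p <- e) p.1 * p.2 = 1 /\ forall a : A, lact a t = ract t a.

End Separable.

Section Galois.
Variables (k : fieldType) (H : bialgType k) (A : comodAlgType H).

Definition coinv : {pred A} := [pred a | coact a == (a ⊗ 1 : (A ⊗ H)%type)].

Lemma coinv_subalg_closed : subalg_closed coinv.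
Proof.
split=> [|c x y|x y]; rewrite !inE.
- by rewrite (coact_monoid_morphism (s := A)).1.
- by move=> /eqP cx /eqP cy; rewrite linearP cx cy pureDl pureZl.
- move=> /eqP cx /eqP cy.
  by rewrite (coact_monoid_morphism (s := A)).2 cx cy pureM mulr1.
Qed.

HB.instance Definition _ :=
  GRing.isSubalgClosed.Build k A coinv coinv_subalg_closed.

Definition can : tensor_over coinv -> A ⊗ H :=
  blift (fun a a' => tmap ( *%R a) idfun (coact a')).

Lemma tmap_mull a (t : (A ⊗ H)%type) :
  tmap ( *%R a) idfun t = (a ⊗ 1) * t.
Proof.
have b : tbalanced (fun (x : A) (h : H) => (a * x) ⊗ h).
  split=> [x y z|x y z|c x y]; first by rewrite mulrDr pureDl.
    by rewrite pureDr.
  by rewrite -scalerAr pureZlr.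
elim/tensor_ind: t => [s t IHs IHt|x h].
  by rewrite mulrBr -IHs -IHt; exact: tliftB.
by rewrite pureM mul1r; exact: tliftE.
Qed.

Lemma can_balanced : balanced
  (fun (b : {b : A | b \in coinv}) (a : A) => a * val b)
  (fun (b : {b : A | b \in coinv}) (a : A) => val b * a)
  (fun (a a' : A) => tmap ( *%R a) idfun (coact a') : (A ⊗ H)%type).
Proof.
split=> [a a' x|a x y|[b /= /eqP cb] a x]; rewrite !tmap_mull.
- by rewrite pureDl mulrDl.
- by rewrite raddfD mulrDr.
- by rewrite (coact_monoid_morphism (s := A)).2 cb mulrA pureM mulr1.
Qed.

Lemma canE a a' :
  can (pure_over coinv a a') = tmap ( *%R a) idfun (coact a').
Proof. exact/bliftE/can_balanced. Qed.

Lemma can_zmod : zmod_morphism can.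
Proof. exact/blift_zmod/can_balanced. Qed.

Definition hopf_galois : Prop := bijective can.

End Galois.

Definition finite_dimensional (k : fieldType) (V : lmodType k) : Prop :=
  exists n : nat, inhabited (Vector.axiom n V).

(* Main.v *)
Require Import Defs.
From HB Require Import structures.
From mathcomp Require Import all_boot all_order all_algebra.
From mathcomp Require Import boolp classical_sets.

Set Implicit Arguments.
Unset Strict Implicit.
Unset Printing Implicit Defensive.

Import GRing.Theory.
Local Open Scope ring_scope.

(** Let [t] in A ⊗ H be the image of the separability idempotent under [can], so
    that (a ⊗ 1) t = t ρ(a) and (id ⊗ ε) t = 1.  Writing 1 ⊗ h as a sum of
    (x ⊗ 1) ρ(y) gives t (1 ⊗ S(h)) = Σ (x ⊗ 1) t (y ⊗ 1), whose H-legs stay in the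
    finite-dimensional span of those of [t].  Applying a functional φ on A with
    φ(1) = 1 yields a finite-dimensional N ⊂ H with N S(H) ⊂ N that contains an
    element w with ε(w) = 1.  As S need not be surjective, one shows separately
    that N is then a right ideal; the elements h = w_1 S(w_2) h lie in the right
    ideal generated by the left legs of Δ(w), which is again finite-dimensional. *)

(** * Linear algebra in spaces of arbitrary dimension *)

Section Subspaces.
Variables (k : fieldType) (U : lmodType k).
Implicit Types (M P : U -> Prop) (s : seq U).

Definition subspace M : Prop :=
  M 0 /\ forall c x y, M x -> M y -> M (c *: x + y).

(** Taken as the intersection of all subspaces containing [s]: membership is used by choosing a
    suitable subspace, and [linear_spanP] recovers coefficients. *)
Definition linear_span s (x : U) : Prop :=
  forall M, subspace M -> (forall y, y \in s -> M y) -> M x.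

(** The vectors of [s] may lie outside [M], so enclosing [M] in a finite span is enough. *)
Definition finspanned M : Prop := exists s, forall x, M x -> linear_span s x.

Definition free_fam n (b : 'I_n -> U) : Prop :=
  forall c : 'I_n -> k, \sum_i c i *: b i = 0 -> forall i, c i = 0.

Lemma linear_span_subspace s : subspace (linear_span s).
Proof.
split=> [M [] //|c x y sx sy M subM sM].
by apply: subM.2; [exact: sx | exact: sy].
Qed.

Lemma mem_linear_span s y : y \in s -> linear_span s y.
Proof. by move=> sy M _; apply. Qed.

Section Closure.
Variables (M : U -> Prop) (subM : subspace M).

Lemma subspaceZ c x : M x -> M (c *: x).
Proof. by move=> Mx; rewrite -[_ *: _]addr0; apply: subM.2 => //; exact: subM.1. Qed.

Lemma subspaceD x y : M x -> M y -> M (x + y).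
Proof. by move=> Mx My; rewrite -[x]scale1r; exact: subM.2. Qed.

Lemma subspaceB x y : M x -> M y -> M (x - y).
Proof. by move=> Mx My; rewrite addrC -scaleN1r; exact: subM.2. Qed.

Lemma subspace_sum (I : Type) (r : seq I) (F : I -> U) :
  (forall i, M (F i)) -> M (\sum_(i <- r) F i).
Proof. by move=> MF; elim/big_ind: _ => //; [exact: subM.1 | exact: subspaceD]. Qed.

Lemma subspace_sum_seq (I : eqType) (r : seq I) (F : I -> U) :
  (forall i, i \in r -> M (F i)) -> M (\sum_(i <- r) F i).
Proof.
move=> MF; rewrite big_seq; elim/big_ind: _ => //; first exact: subM.1.
exact: subspaceD.
Qed.

End Closure.

Lemma linear_spanP s x : linear_span s x -> exists c : 'I_(size s) -> k, x = \sum_i c i *: s`_i.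
Proof.
move/(_ (fun x => exists c : 'I_(size s) -> k, x = \sum_i c i *: s`_i)).
apply; first split.
- by exists (fun=> 0); rewrite big1 // => i _; rewrite scale0r.
- move=> a _ _ [c ->] [d ->]; exists (fun i => a * c i + d i).
  rewrite scaler_sumr -big_split /=; apply: eq_bigr => i _.
  by rewrite scalerA scalerDl.
move=> y sy; have lt_s: (index y s < size s)%N by rewrite index_mem.
exists (fun i => (i == Ordinal lt_s)%:R).
rewrite (bigD1 (Ordinal lt_s)) //= eqxx scale1r nth_index // big1 ?addr0 //.
by move=> i /negPf->; rewrite scale0r.
Qed.

(* A linear functional is the coordinate along [x] with respect to a maximal
   subspace containing [M] and missing [x], which is a hyperplane. *)
Lemma separating_functional M x : subspace M -> ~ M x ->
  exists f : {linear U -> k^o}, (forall y, M y -> f y = 0) /\ f x = 1.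
Proof.
move=> subM nMx.
pose T := {N : U -> Prop | [/\ subspace N, forall y, M y -> N y & ~ N x]}.
pose R (N N' : T) := `[< forall y, sval N y -> sval N' y >].
have [||A totA|[N [subN MN nNx]] maxN] := @ZL_preorder T (exist _ M (And3 subM (fun _ => id) nMx)) R.
- by move=> N; apply/asboolP.
- by move=> N1 N2 N3 /asboolP h1 /asboolP h2; apply/asboolP => y /h1/h2.
(* A nonempty chain is bounded by its union, the empty one by [M] itself. *)
- have [[N0 A0]|nA] := pselect (exists N, A N); last first.
    exists (exist _ M (And3 subM (fun _ => id) nMx)) => N AN.
    by case: nA; exists N.
  pose V y := exists2 N, A N & sval N y.
  suff pV : [/\ subspace V, forall y, M y -> V y & ~ V x].
    by exists (exist _ V pV) => N AN; apply/asboolP => y Ny; exists N.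
  split; [split|move=> y My|].
  - by exists N0 => //; case: (svalP N0) => [] [].
  - move=> c y z [N1 A1 N1y] [N2 A2 N2z].
    have [/asboolP le12|/asboolP le21] := totA _ _ A1 A2.
      by exists N2 => //; have [[_ h] _ _] := svalP N2; apply: h => //; exact: le12.
    by exists N1 => //; have [[_ h] _ _] := svalP N1; apply: h => //; exact: le21.
  - by exists N0 => //; have [_ MN0 _] := svalP N0; exact: MN0.
  - by case=> N _; have [] := svalP N.
(* Maximality forces every [y] into N + kx: otherwise N + ky would be a larger subspace still
   missing [x]. *)
have coord y : exists c, N (y - c *: x).
  apply: contrapT => /forallNP nNy.
  pose N' z := exists c, N (z - c *: y).
  have NN' z : N z -> N' z by move=> Nz; exists 0; rewrite scale0r subr0.
  have subN' : subspace N'.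
    split; first by apply: NN'; exact: subN.1.
    move=> a z1 z2 [c1 h1] [c2 h2]; exists (a * c1 + c2).
    have := subN.2 a _ _ h1 h2.
    by rewrite scalerBr scalerA scalerDl opprD addrACA.
  have nN'x : ~ N' x.
    case=> c; have [->|c0] := eqVneq c 0; first by rewrite scale0r subr0.
    move/(subspaceZ subN (- c^-1)).
    rewrite scalerBr scalerA mulNr mulVf // scaleN1r opprK addrC scaleNr.
    exact: nNy.
  have /asboolP/(_ y) Ny :
      R (exist _ N' (And3 subN' (fun z Mz => NN' z (MN z Mz)) nN'x))
        (exist _ N (And3 subN MN nNx)).
    by apply: maxN; apply/asboolP.
  apply: (nNy 0); rewrite scale0r subr0; apply: Ny.
  by exists 1; rewrite scale1r subrr; exact: subN.1.
have [f fN] := choice coord.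
(* Two distinct coordinates of [y] would put a nonzero multiple of [x] in [N]. *)
have f_uniq y c : N (y - c *: x) -> f y = c.
  move=> Nc; apply/eqP; rewrite -subr_eq0; apply/negP => /negP fc.
  apply: (nNx); have := subspaceZ subN (f y - c)^-1 (subspaceB subN Nc (fN y)).
  by rewrite opprB [_ + (_ - y)]addrC addrA subrK -scalerBl scalerA mulVf // scale1r.
have f_lin : linear (f : U -> k^o).
  move=> c y z; apply: f_uniq; have := subN.2 c _ _ (fN y) (fN z).
  by rewrite scalerBr scalerA scalerDl opprD addrACA.
pose g := HB.pack_for {linear U -> k^o} (f : U -> k^o)
  (GRing.isLinear.Build k U k^o _ (f : U -> k^o) f_lin).
exists g; split=> /= [y My|].
  by apply: f_uniq; rewrite scale0r subr0; exact: (MN).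
by apply: f_uniq; rewrite scale1r subrr; exact: subN.1.
Qed.

(** A vector in the left kernel of the coefficient matrix is a linear relation among the [b i],
    hence zero; the matrix thus has rank [m], at most its number of columns. *)
Lemma free_spanned_bound m n (b : 'I_m -> U) (d : 'I_n -> U) : free_fam b ->
  (forall i, exists c : 'I_n -> k, b i = \sum_j c j *: d j) -> (m <= n)%N.
Proof.
move=> free_b /choice[C bC]; pose M := \matrix_(i, j) C i j.
rewrite -(eqP (_ : row_free M)) ?rank_leq_col // -kermx_eq0.
apply/eqP/row_matrixP => l; rewrite row0; set u := row l _.
have uM : u *m M = 0 by apply/sub_kermxP; exact: row_sub.
apply/rowP => i; rewrite [RHS]mxE; move: i; apply: free_b.
under eq_bigr do rewrite bC scaler_sumr.
rewrite exchange_big big1 // => j _.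
under eq_bigr do rewrite scalerA.
rewrite -scaler_suml; have /rowP/(_ j) := uM.
by rewrite !mxE; under eq_bigr do rewrite [M _ _]mxE; move=> ->; rewrite scale0r.
Qed.

(** A free family in [M] of maximal length is a basis; lengths are bounded by the size of a spanning
    list. *)
Lemma finspanned_basis M : subspace M -> finspanned M ->
  exists n (b : 'I_n -> U), [/\ free_fam b, forall i, M (b i)
    & forall x, M x -> exists c : 'I_n -> k, x = \sum_i c i *: b i].
Proof.
move=> subM [s Ms].
pose Q n := `[< exists b : 'I_n -> U, free_fam b /\ forall i, M (b i) >].
have Q0 : exists n, Q n.
  by exists 0%N; apply/asboolP; exists (fun _ : 'I_0 => 0); split=> [c _ i|i]; case: i.
have Qs n : Q n -> (n <= size s)%N.
  move=> /asboolP[b [free_b Mb]]; apply: (@free_spanned_bound _ _ b (fun i => s`_i)) free_b _.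
  by move=> i; apply: linear_spanP; exact: Ms.
have [n /asboolP[b [free_b Mb]] maxn] := ex_maxnP Q0 Qs.
exists n, b; split=> // x Mx; apply: contrapT => /forallNP nx.
suff /maxn : Q n.+1 by rewrite ltnn.
apply/asboolP; exists (fun i => if unlift ord0 i is Some j then b j else x).
split=> [c|i]; last by case: unlift.
rewrite big_ord_recl unlift_none; under eq_bigr do rewrite liftK.
move=> c0; have c00 : c ord0 = 0.
  (* A nonzero coefficient of [x] could be inverted to express [x] through the [b i], against
     [nx]. *)
  apply/eqP/negP => /negP nz; apply: (nx (fun i => - (c ord0)^-1 * c (lift ord0 i))).
  under eq_bigr do rewrite -scalerA.
  rewrite -scaler_sumr; move/eqP: c0; rewrite addrC addr_eq0 => /eqP->.
  by rewrite scaleNr scalerN opprK scalerA mulVf // scale1r.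
move: c0; rewrite c00 scale0r add0r => /free_b ci i.
by case: (unliftP ord0 i) => [j|] ->.
Qed.

(** In a basis of [M] the restriction of [T] is a square matrix with zero left kernel, hence
    invertible; the preimage comes from its inverse. *)
Lemma inj_stable_onto M (T : U -> U) : subspace M -> finspanned M -> linear T ->
    (forall x, M x -> M (T x)) -> (forall x, T x = 0 -> x = 0) ->
  forall x, M x -> exists2 y, M y & x = T y.
Proof.
move=> subM finM linT MT injT x Mx.
have [n [b [free_b Mb genb]]] := finspanned_basis subM finM.
pose f := HB.pack_for {linear U -> U} T (GRing.isLinear.Build k U U _ T linT).
have Tsum (c : 'I_n -> k) : T (\sum_i c i *: b i) = \sum_i c i *: T (b i).
  by rewrite -[T]/(f : U -> U) linear_sum; apply: eq_bigr => i _; rewrite linearZ.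
have /choice[C TC] : forall i, exists c : 'I_n -> k, T (b i) = \sum_j c j *: b j.
  by move=> i; exact/genb/MT.
pose A := \matrix_(i, j) C i j.
have TA (u : 'rV_n) : T (\sum_i u 0 i *: b i) = \sum_j (u *m A) 0 j *: b j.
  rewrite Tsum; under eq_bigr do rewrite TC scaler_sumr.
  rewrite exchange_big; apply: eq_bigr => j _ /=.
  by rewrite mxE scaler_suml; apply: eq_bigr => i _; rewrite scalerA mxE.
have unitA : A \in unitmx.
  rewrite -row_free_unit -kermx_eq0; apply/eqP/row_matrixP => l; rewrite row0.
  set u := row l _; have uA : u *m A = 0 by apply/sub_kermxP; exact: row_sub.
  apply/rowP => i; rewrite [RHS]mxE; move: i; apply: free_b; apply: injT.
  by rewrite TA uA big1 // => j _; rewrite mxE scale0r.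
have [c ->] := genb x Mx; pose u := (\row_i c i) *m invmx A.
exists (\sum_i u 0 i *: b i).
  by apply: subspace_sum => // i; exact: subspaceZ.
by rewrite TA mulmxKV //; apply: eq_bigr => i _; rewrite mxE.
Qed.

Lemma finspanned_finite_dimensional : finspanned (fun=> True) ->
  finite_dimensional U.
Proof.
move=> finU; have [//|n [b [free_b _ genb]]] := finspanned_basis _ finU.
have /choice[f fb] x := genb x I.
have f_uniq x (c : 'I_n -> k) : x = \sum_i c i *: b i -> forall i, f x i = c i.
  move=> xc i; apply/eqP; rewrite -subr_eq0; apply/eqP; move: i.
  apply: free_b; under eq_bigr do rewrite scalerBl.
  by rewrite sumrB -fb -xc subrr.
exists n; constructor; exists (fun x => \row_i f x i).
  move=> c x y; apply/rowP => i; rewrite !mxE.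
  apply: (f_uniq _ (fun i => c * f x i + f y i)).
  under eq_bigr do rewrite scalerDl -scalerA.
  by rewrite big_split /= -scaler_sumr -!fb.
exists (fun u : 'rV_n => \sum_i u 0 i *: b i) => [x|u].
  by under eq_bigr do rewrite mxE; rewrite -fb.
by apply/rowP => i; rewrite mxE; exact: f_uniq.
Qed.

End Subspaces.

(** * Finite decompositions of tensors and Sweedler sums *)

Lemma zmod_morphism_sum (V W : zmodType) (f : V -> W) (I : Type) (r : seq I)
    (F : I -> V) : zmod_morphism f -> f (\sum_(i <- r) F i) = \sum_(i <- r) f (F i).
Proof.
move=> fB; have f0 : f 0 = 0 by have := fB 0 0; rewrite !subrr.
have fD x y : f (x + y) = f x + f y.
  by rewrite -[y in LHS]opprK fB -[- y]sub0r fB f0 sub0r opprK.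
by elim: r => [|i r IH]; rewrite ?big_nil // !big_cons fD IH.
Qed.

Lemma linear_bundle (k : fieldType) (U V : lmodType k) (f : U -> V) :
  linear f -> exists g : {linear U -> V}, g =1 f.
Proof.
move=> linf.
by exists (HB.pack_for {linear U -> V} f (GRing.isLinear.Build k U V _ f linf)).
Qed.

Section TensorSums.
Variable k : fieldType.
Implicit Types U V W : lmodType k.

Lemma tensor_sumP U V (t : (U ⊗ V)%type) :
  exists s : seq (U * V), t = \sum_(p <- s) p.1 ⊗ p.2.
Proof.
elim/tensor_ind: t => [_ _ [s ->] [r ->]|u v]; last first.
  by exists [:: (u, v)]; rewrite big_seq1.
exists (s ++ [seq (- p.1, p.2) | p <- r]).
rewrite big_cat big_map -sumrN /=; congr (_ + _); apply: eq_bigr => p _ /=.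
by rewrite -scaleN1r pureZl scaleN1r.
Qed.

Lemma pure_suml U V (I : Type) (r : seq I) (u : I -> U) (v : V) :
  (\sum_(i <- r) u i) ⊗ v = \sum_(i <- r) u i ⊗ v.
Proof.
rewrite (@zmod_morphism_sum _ _ ((@pure _ _ _)^~ v)) // => x y.
by rewrite pureDl -scaleN1r pureZl scaleN1r.
Qed.

Lemma pure_sumr U V (I : Type) (r : seq I) (u : U) (v : I -> V) :
  u ⊗ (\sum_(i <- r) v i) = \sum_(i <- r) u ⊗ v i.
Proof.
rewrite (@zmod_morphism_sum _ _ (pure u)) // => x y.
by rewrite pureDr -scaleN1r pureZr scaleN1r.
Qed.

(* A chosen decomposition of a tensor: the sum over [p <- legs (comul x)] of
   [f p.1 p.2] is Sweedler's [f(x_1, x_2)]. *)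
Definition legs U V (t : (U ⊗ V)%type) : seq (U * V) := sval (cid (tensor_sumP t)).

Lemma legsE U V (t : (U ⊗ V)%type) : t = \sum_(p <- legs t) p.1 ⊗ p.2.
Proof. exact: (svalP (cid (tensor_sumP t))). Qed.

Lemma tlift_sum U V (W : zmodType) (f : U -> V -> W) (I : Type) (r : seq I)
    (u : I -> U) (v : I -> V) : tbalanced f ->
  tlift f (\sum_(i <- r) u i ⊗ v i) = \sum_(i <- r) f (u i) (v i).
Proof.
move=> bf; rewrite (zmod_morphism_sum _ _ (tliftB bf)).
by apply: eq_bigr => i _; rewrite tliftE.
Qed.

Lemma tlift_legs U V (W : zmodType) (f : U -> V -> W) t : tbalanced f ->
  tlift f t = \sum_(p <- legs t) f p.1 p.2.
Proof. by move=> bf; rewrite [in LHS](legsE t) tlift_sum. Qed.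

Lemma tmap_legs U V U' V' (f : {linear U -> U'}) (g : {linear V -> V'}) t :
  tmap f g t = \sum_(p <- legs t) f p.1 ⊗ g p.2.
Proof. exact/tlift_legs/tmap_balanced. Qed.

Lemma tlift_linear U V W (f : U -> V -> W) : tbalanced f ->
  (forall c u v, f (c *: u) v = c *: f u v) -> linear (tlift f).
Proof. by move=> bf fZ c s t; rewrite tliftD // tliftZ. Qed.

(** The right legs are expanded in a basis of their span. With them independent, a functional on [U]
    that kills [t] when applied to its left legs must kill each [u i]. *)
Lemma tensor_free_legs U V (t : (U ⊗ V)%type) :
  exists n (u : 'I_n -> U) (v : 'I_n -> V), free_fam v /\ t = \sum_i u i ⊗ v i.
Proof.
pose s := [seq p.2 | p <- legs t].
have fin_s : finspanned (linear_span s) by exists s.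
have [n [v [free_v _ gen_v]]] := finspanned_basis (linear_span_subspace s) fin_s.
have /choice[c cE] (p : U * V) : exists c : 'I_n -> k,
    p \in legs t -> p.2 = \sum_i c i *: v i.
  have [ps|] := boolP (p \in legs t); last by exists (fun=> 0).
  have [|c ->] := gen_v p.2; last by exists c.
  by apply: mem_linear_span; exact: (map_f snd ps).
exists n, (fun i => \sum_(p <- legs t) c p i *: p.1), v; split=> //.
rewrite [LHS]legsE.
transitivity (\sum_(p <- legs t) \sum_i (c p i *: p.1) ⊗ v i).
  rewrite big_seq [RHS]big_seq; apply: eq_bigr => p /cE {1}->.
  by rewrite pure_sumr; apply: eq_bigr => i _; rewrite pureZlr.
by rewrite exchange_big; apply: eq_bigr => i _ /=; rewrite pure_suml.
Qed.

(** Exactly what lets [f] factor through both bracketings of the triple tensor product. *)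
Definition tribalanced U V V' (W : zmodType) (f : U -> V -> V' -> W) : Prop :=
  (forall w, tbalanced (fun u v => f u v w)) /\ forall u, tbalanced (f u).

Section Tribalanced.
Variables (U V V' : lmodType k) (W : zmodType) (f : U -> V -> V' -> W).
Hypothesis bf : tribalanced f.

Lemma tribalanced_left :
  tbalanced (fun (t : (U ⊗ V)%type) w => tlift (fun u v => f u v w) t).
Proof.
have [b1 b2] := bf.
split=> [s t w|t w w'|c t w]; first exact: tliftD.
- elim/tensor_ind: t => [s t IHs IHt|u v].
    by rewrite !tliftB // IHs IHt opprD addrACA.
  by rewrite !tliftE // (balDr (b2 u)).
- rewrite /=; elim/tensor_ind: t => [s t IHs IHt|u v] /=.
    by rewrite scalerBr !tliftB // IHs IHt.
  by rewrite -pureZr !tliftE // (balS (b2 u)).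
Qed.

(** The map [d] will be the identity of a tensor product or a comultiplication. *)
Lemma tribalanced_right (X : lmodType k) (d : {linear X -> (V ⊗ V')%type}) :
  tbalanced (fun u x => tlift (f u) (d x)).
Proof.
have [b1 b2] := bf.
split=> [u u' x|u x x'|c u x].
- elim/tensor_ind: (d x) => [s t IHs IHt|v w].
    by rewrite !tliftB // IHs IHt opprD addrACA.
  by rewrite !tliftE // (balDl (b1 w)).
- by rewrite raddfD tliftD.
- rewrite /= linearZ /=; elim/tensor_ind: (d x) => [s t IHs IHt|v w].
    by rewrite scalerBr !tliftB // IHs IHt.
  by rewrite -pureZl !tliftE // (balS (b1 w)).
Qed.

End Tribalanced.

(** Apply the map m ⊗ t ↦ [tlift (f m) t] to both sides of the coassociativity identity. A general
    [d] covers comultiplication and coaction at once. *)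
Lemma coassoc_sum (C : coalgType k) (M : lmodType k) (W : zmodType)
    (d : {linear M -> (M ⊗ C)%type}) (f : M -> C -> C -> W) x :
    (forall x, tassoc (tmap d idfun (d x)) = tmap idfun comul (d x)) ->
    tribalanced f ->
  \sum_(p <- legs (d x)) \sum_(q <- legs (d p.1)) f q.1 q.2 p.2 =
  \sum_(p <- legs (d x)) \sum_(q <- legs (comul p.2)) f p.1 q.1 q.2.
Proof.
move=> dA bf; have [b1 b2] := bf.
have bF : tbalanced (fun m (t : (C ⊗ C)%type) => tlift (f m) t).
  exact: (tribalanced_right bf (@idfun (C ⊗ C)%type)).
have b3 : tribalanced (fun (m : M) (c c' : C) => m ⊗ (c ⊗ c')).
  split=> y; split=> *; rewrite ?(pureDl, pureDr) //.
    by rewrite pureZlr pureZl.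
  by rewrite pureZlr.
have assocB : zmod_morphism (@tassoc k M C C).
  exact: (tliftB (tribalanced_left b3)).
have := congr1 (tlift (fun m t => tlift (f m) t)) (dA x).
rewrite !tmap_legs (zmod_morphism_sum _ _ assocB).
rewrite !(zmod_morphism_sum _ _ (tliftB bF)).
have -> : \sum_(p <- legs (d x)) tlift (fun m t => tlift (f m) t)
      (tassoc (d p.1 ⊗ p.2)) =
    \sum_(p <- legs (d x)) \sum_(q <- legs (d p.1)) f q.1 q.2 p.2.
  apply: eq_bigr => p _; rewrite [in LHS](legsE (d p.1)).
  rewrite pure_suml (zmod_morphism_sum _ _ assocB) (zmod_morphism_sum _ _ (tliftB bF)).
  by apply: eq_bigr => q _; rewrite tassocE !tliftE.
by move->; apply: eq_bigr => p _; rewrite tliftE // tlift_legs.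
Qed.

End TensorSums.

Lemma counitZ (k : fieldType) (C : coalgType k) c (x : C) :
  counit (c *: x) = c * (counit x : k) :> k.
Proof. by rewrite linearZ. Qed.

Lemma counit_balanced (k : fieldType) (C : coalgType k) (V : lmodType k) :
  tbalanced (fun (c : C) (v : V) => (counit c : k) *: v).
Proof.
split=> *; rewrite ?raddfD ?scalerDl ?scalerDr //.
by rewrite /= counitZ scalerA mulrC.
Qed.

Lemma balanced_counit (k : fieldType) (C : coalgType k) (V : lmodType k) :
  tbalanced (fun (v : V) (c : C) => (counit c : k) *: v).
Proof.
split=> *; rewrite ?raddfD ?scalerDl ?scalerDr //.
by rewrite /= counitZ scalerA mulrC.
Qed.

Section CoalgebraSums.
Variables (k : fieldType) (C : coalgType k) (W : lmodType k).

Lemma counitl_sum (g : {linear C -> W}) x :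
  \sum_(p <- legs (comul x)) (counit p.1 : k) *: g p.2 = g x.
Proof.
rewrite -[in RHS](counitl x) tlift_legs; last exact: counit_balanced.
by rewrite linear_sum; apply: eq_bigr => p _; rewrite linearZ.
Qed.

Lemma counitr_sum (g : {linear C -> W}) x :
  \sum_(p <- legs (comul x)) (counit p.2 : k) *: g p.1 = g x.
Proof.
rewrite -[in RHS](counitr x) tlift_legs; last exact: balanced_counit.
by rewrite linear_sum; apply: eq_bigr => p _; rewrite linearZ.
Qed.

Lemma comul_coassoc (V : zmodType) (f : C -> C -> C -> V) x : tribalanced f ->
  \sum_(p <- legs (comul x)) \sum_(q <- legs (comul p.1)) f q.1 q.2 p.2 =
  \sum_(p <- legs (comul x)) \sum_(q <- legs (comul p.2)) f p.1 q.1 q.2.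
Proof. by move=> bf; apply: coassoc_sum => //; exact: comulA. Qed.

Lemma comul_sum_linear (f : C -> C -> W) :
    tbalanced f -> (forall c u v, f (c *: u) v = c *: f u v) ->
  linear (fun x => \sum_(p <- legs (comul x)) f p.1 p.2).
Proof.
move=> bf fZ c x y; rewrite -!tlift_legs // linearP.
exact: tlift_linear.
Qed.

End CoalgebraSums.

(** * From stability under the antipode to right ideals and finite dimension *)

Section HopfIdeals.
Variables (k : fieldType) (H : hopfAlgType k).

Lemma antipodel_sum (x : H) :
  \sum_(p <- legs (comul x)) antipode p.1 * p.2 = (counit x : k) *: 1.
Proof.
rewrite -antipodel tlift_legs //; split=> *.
- by rewrite raddfD mulrDl.
- by rewrite mulrDr.
- by rewrite linearZ /= -scalerAl -scalerAr.
Qed.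

Lemma antipoder_sum (x : H) :
  \sum_(p <- legs (comul x)) p.1 * antipode p.2 = (counit x : k) *: 1.
Proof.
rewrite -antipoder tlift_legs //; split=> *.
- by rewrite mulrDl.
- by rewrite raddfD mulrDr.
- by rewrite linearZ /= -scalerAl -scalerAr.
Qed.

(* [T (y ⊗ z) = y S(z_1) ⊗ z_2], with left inverse [T' (y ⊗ z) = y z_1 ⊗ z_2]. *)
Let T := tlift (fun y z : H =>
  tlift (fun z1 z2 => (y * antipode z1) ⊗ z2) (comul z)).
Let T' := tlift (fun y z : H => tlift (fun z1 z2 => (y * z1) ⊗ z2) (comul z)).

Let tri1 : tribalanced (fun y z1 z2 : H => (y * antipode z1) ⊗ z2).
Proof.
split=> x; split=> *; rewrite ?raddfD ?(mulrDl, mulrDr) ?(pureDl, pureDr) //=.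
  by rewrite linearZ /= -scalerAl -scalerAr.
by rewrite linearZ /= -scalerAr pureZl pureZr.
Qed.

Let tri2 : tribalanced (fun y z1 z2 : H => (y * z1) ⊗ z2).
Proof.
split=> x; split=> *; rewrite ?(mulrDl, mulrDr) ?(pureDl, pureDr) //=.
  by rewrite -scalerAl -scalerAr.
by rewrite -scalerAr pureZl pureZr.
Qed.

Let TE y z : T (y ⊗ z) = \sum_(p <- legs (comul z)) (y * antipode p.1) ⊗ p.2.
Proof.
rewrite /T tliftE; last exact: (tribalanced_right tri1).
by apply: tlift_legs; case: tri1.
Qed.

Let T'E y z : T' (y ⊗ z) = \sum_(p <- legs (comul z)) (y * p.1) ⊗ p.2.
Proof.
rewrite /T' tliftE; last exact: (tribalanced_right tri2).
by apply: tlift_legs; case: tri2.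
Qed.

Let T_linear : linear T.
Proof.
apply: tlift_linear => [|c y z]; first exact: (tribalanced_right tri1).
rewrite !tlift_legs; try by case: tri1.
by rewrite scaler_sumr; apply: eq_bigr => p _; rewrite -scalerAl pureZl.
Qed.

Let T'B : zmod_morphism T'.
Proof. exact/tliftB/(tribalanced_right tri2). Qed.

Let TB : zmod_morphism T.
Proof. exact/tliftB/(tribalanced_right tri1). Qed.

Let T'T : cancel T T'.
Proof.
move=> t; elim/tensor_ind: t => [s t IHs IHt|y z]; first by rewrite TB T'B IHs IHt.
rewrite TE (zmod_morphism_sum _ _ T'B).
under eq_bigr do rewrite T'E.
(* Regrouping gives y S(z_1) z_2 ⊗ z_3, which collapses to y ⊗ ε(z_1) z_2. *)
rewrite -(@comul_coassoc _ _ _ (fun a b c : H => (y * antipode a * b) ⊗ c)); last first.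
  split=> x; split=> *; rewrite ?raddfD ?(mulrDl, mulrDr, pureDl, pureDr) //=.
    by rewrite linearZ /= -!scalerAr -!scalerAl.
  by rewrite -scalerAr pureZlr.
transitivity (\sum_(p <- legs (comul z)) y ⊗ ((counit p.1 : k) *: p.2)).
  apply: eq_bigr => p _; rewrite -pureZlr.
  rewrite -[_ *: y]mulr1 -scalerAl scalerAr -antipodel_sum mulr_sumr.
  by rewrite pure_suml; apply: eq_bigr => q _; rewrite mulrA.
by rewrite -pure_sumr (counitl_sum (@idfun H)).
Qed.

(* [T] permutes the finite-dimensional space [P] of all g(h_1) ⊗ h_2 with [g]
   linear from [H] to [N].  If [w ⊗ h = T (g(h_1) ⊗ h_2)], applying [T'] and then
   [id ⊗ counit] gives [w h = g(h)], which lies in [N]. *)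
Lemma stable_by_antipode_ideal (N : H -> Prop) : subspace N -> finspanned N ->
    (forall y h, N y -> N (y * antipode h)) ->
  forall y h, N y -> N (y * h).
Proof.
move=> subN [s Ns] NS w h Nw.
pose G (g : H -> H) := \sum_(p <- legs (comul h)) g p.1 ⊗ p.2.
pose P t := exists g : {linear H -> H}, (forall x, N (g x)) /\ t = G g.
have subP : subspace P.
  split=> [|c _ _ [g1 [Ng1 ->]] [g2 [Ng2 ->]]].
    exists (\0 : {linear H -> H}); split=> [x|]; first exact: subN.1.
    by rewrite /G big1 // => p _ /=; rewrite -(scale0r 0) pureZl scale0r.
  have [|g gE] := @linear_bundle k H H (fun x => c *: g1 x + g2 x).
    move=> a x y; rewrite (linearP g1) (linearP g2) !scalerDr !scalerA [c * a]mulrC.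
    by rewrite addrACA.
  exists g; split=> [x|]; first by rewrite gE; exact: subN.2.
  rewrite /G scaler_sumr -big_split; apply: eq_bigr => p _ /=.
  by rewrite gE pureDl pureZl.
have finP : finspanned P.
  (* Each g(h_1) lies in the span of [s], and only finitely many right legs h_2 occur. *)
  pose S := [seq y ⊗ p.2 | y <- s, p <- legs (comul h)].
  exists S => _ [g [Ng ->]].
  apply: (subspace_sum_seq (linear_span_subspace S)) => p hp.
  have subQ : subspace (fun y => linear_span S (y ⊗ p.2)).
    split=> [|c x y Sx Sy].
      by rewrite -(scale0r 0) pureZl scale0r; exact: (linear_span_subspace S).1.
    by rewrite pureDl pureZl; exact: (linear_span_subspace S).2.
  apply: (Ns _ (Ng p.1) _ subQ) => y sy; apply: mem_linear_span.
  exact: (allpairs_f (fun y p => y ⊗ p.2)).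
have PT t : P t -> P (T t).
  case=> g [Ng ->].
  (* [T] sends g(h_1) ⊗ h_2 to g(h_1) S(h_2) ⊗ h_3, so [g'] is the convolution product of [g] with
     the antipode. *)
  have [|g' g'E] := @linear_bundle k H H
      (fun x => \sum_(p <- legs (comul x)) g p.1 * antipode p.2).
    apply: (comul_sum_linear (f := fun a b => g a * antipode b)) => [|c u v]; last first.
      by rewrite linearZ /= scalerAl.
    split=> *; rewrite ?raddfD ?(mulrDl, mulrDr) //=.
    by rewrite !linearZ /= -scalerAl -scalerAr.
  exists g'; split=> [x|].
    by rewrite g'E; apply: subspace_sum => // p; exact: NS.
  rewrite /G (zmod_morphism_sum _ _ TB); under eq_bigr do rewrite TE.
  rewrite -(@comul_coassoc _ _ _ (fun a b c : H => (g a * antipode b) ⊗ c)); last first.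
    split=> x; split=> *; rewrite ?raddfD ?(mulrDl, mulrDr, pureDl, pureDr) //=.
      by rewrite !linearZ /= -!scalerAr -!scalerAl.
    by rewrite linearZ /= -scalerAr pureZlr.
  by apply: eq_bigr => p _; rewrite g'E pure_suml.
(* By the counit law, the map x ↦ ε(x) w represents w ⊗ h. *)
have Pw : P (w ⊗ h).
  have [|g gE] := @linear_bundle k H H (fun x => (counit x : k) *: w).
    by move=> c x y; rewrite linearP scalerDl scalerA.
  exists g; split=> [x|]; first by rewrite gE; exact: subspaceZ.
  rewrite /G -[in LHS](counitl_sum (@idfun H) h : _ = h).
  by rewrite pure_sumr; apply: eq_bigr => p _; rewrite gE pureZlr.
have T0 t : T t = 0 -> t = 0.
  by move=> Tt0; rewrite -[t]T'T Tt0 -(subrr 0) T'B !subrr.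
have [_ [g [Ng ->]] wT] := inj_stable_onto subP finP T_linear PT T0 Pw.
have /(congr1 (tlift (fun a b : H => (counit b : k) *: a))) : T' (w ⊗ h) = G g.
  by rewrite wT T'T.
rewrite T'E /G !tlift_sum; try exact: balanced_counit.
rewrite (counitr_sum g) => wg.
have [|g' g'E] := @linear_bundle k H H (fun x => w * x).
  by move=> c x y; rewrite mulrDr scalerAr.
rewrite -g'E -(counitr_sum g'); under eq_bigr do rewrite g'E.
by rewrite wg.
Qed.

(* Since [h = w_1 S(w_2) h] when [counit w = 1], it suffices that the left legs
   of [comul w] generate a finite-dimensional right ideal; this follows from
   [w_1 x ⊗ w_2 = comul (w x_1) (1 ⊗ S(x_2))]. *)
Lemma ideal_finite_dimensional (N : H -> Prop) (w : H) : finspanned N ->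
    (forall y h, N y -> N (y * h)) -> N w -> (counit w : k) = 1 ->
  finite_dimensional H.
Proof.
move=> [s Ns] NM Nw w1; apply: finspanned_finite_dimensional.
(* Left legs are taken for all spanning vectors of [N], not just for [w], because Δ(w x) will be
   needed for every [x]. If [h] were outside their span, a functional [phi] would kill the span and
   take the value 1 at [h]. *)
pose s' := flatten [seq [seq p.1 | p <- legs (comul y)] | y <- s].
exists s' => h _; apply: contrapT => nh.
have [phi [phi0 phih]] := separating_functional (linear_span_subspace s') nh.
have phiZ c a : (phi (c *: a) : k) = c * (phi a : k) by rewrite linearZ.
have bal_phi x : tbalanced (fun a b : H => (phi (a * x) : k) *: b).
  split=> *; rewrite ?mulrDl ?raddfD ?(scalerDl, scalerDr) //=.
  by rewrite -scalerAl phiZ scalerA mulrC.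
have phi_comul y : \sum_(p <- legs (comul y)) (phi p.1 : k) *: p.2 =
    tlift (fun a b : H => (phi (a * 1) : k) *: b) (comul y).
  by rewrite tlift_legs //; apply: eq_bigr => p _; rewrite mulr1.
have phiN y : N y -> \sum_(p <- legs (comul y)) (phi p.1 : k) *: p.2 = 0.
  move=> Ny.
  (* The span of [s] is contained in the kernel of (phi ⊗ id)Δ, since that kernel is a subspace
     containing [s]. *)
  apply: (Ns y Ny (fun y => \sum_(p <- legs (comul y)) (phi p.1 : k) *: p.2 = 0)) => [|z sz].
    split=> [|c a b]; rewrite !phi_comul.
      by rewrite linear0 -(subrr 0) tliftB // !subrr.
    rewrite linearP tliftD // tliftZ // => [->->|d u v].
      by rewrite scaler0 addr0.
    by rewrite -scalerAl phiZ scalerA.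
  rewrite big_seq big1 // => p zp; rewrite phi0 ?scale0r //.
  apply: mem_linear_span; apply/flattenP; exists [seq p.1 | p <- legs (comul z)].
    exact: (map_f (fun y => [seq p.1 | p <- legs (comul y)])).
  exact: (map_f fst).
(* With g(x) = phi(w_1 x) w_2, one has g(x) = g(x_1) x_2 S(x_3), and g(x_1) x_2 = (phi ⊗ id)Δ(w x)
   vanishes because w x is in [N]. *)
have phi_ideal x : \sum_(p <- legs (comul w)) (phi (p.1 * x) : k) *: p.2 = 0.
  have [|g gE] := @linear_bundle k H H
      (fun x => \sum_(p <- legs (comul w)) (phi (p.1 * x) : k) *: p.2).
    move=> c a b; rewrite scaler_sumr -big_split; apply: eq_bigr => p _ /=.
    by rewrite mulrDr -scalerAr raddfD /= phiZ scalerDl scalerA.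
  rewrite -gE -(counitr_sum g).
  transitivity (\sum_(q <- legs (comul x)) \sum_(r <- legs (comul q.2))
      g q.1 * r.1 * antipode r.2).
    apply: eq_bigr => q _; rewrite -[g _ in LHS]mulr1 scalerAr -antipoder_sum.
    by rewrite mulr_sumr; apply: eq_bigr => r _; rewrite mulrA.
  rewrite -(@comul_coassoc _ _ _ (fun a b c : H => g a * b * antipode c)); last first.
    split=> y; split=> *; rewrite ?raddfD ?(mulrDl, mulrDr) //=.
      by rewrite linearZ /= -!scalerAr -!scalerAl.
    by rewrite linearZ /= -!scalerAr -!scalerAl.
  rewrite big1 // => q _; rewrite -mulr_suml.
  rewrite (_ : \sum_(r <- _) _ = 0) ?mul0r //.
  rewrite -[RHS](phiN _ (NM _ q.1 Nw)) phi_comul comul_monoid_morphism.2.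
  rewrite [in RHS](legsE (comul q.1)) mulr_sumr (zmod_morphism_sum _ _ (tliftB (bal_phi 1))).
  apply: eq_bigr => r _.
  rewrite [in RHS](legsE (comul w)) mulr_suml (zmod_morphism_sum _ _ (tliftB (bal_phi 1))).
  rewrite gE mulr_suml; apply: eq_bigr => p _.
  by rewrite pureM tliftE // mulr1 scalerAl.
(* Independent right legs split [phi_ideal] into phi(u_i x) = 0 for each i. Then h = Σ u_i S(v_i) h
   gives phi(h) = 0, a contradiction. *)
have [n [u [v [free_v wE]]]] := tensor_free_legs (comul w).
have phi_u x i : (phi (u i * x) : k) = 0.
  move: i; apply: free_v; rewrite -[RHS](phi_ideal x) -(tlift_legs _ (bal_phi x)) wE.
  by rewrite tlift_sum.
have bal_S : tbalanced (fun a b : H => a * antipode b).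
  split=> *; rewrite ?raddfD ?(mulrDl, mulrDr) //=.
  by rewrite linearZ /= -scalerAl -scalerAr.
have : h = \sum_i u i * (antipode (v i) * h).
  under eq_bigr do rewrite mulrA.
  rewrite -mulr_suml -(tlift_sum _ _ _ bal_S) -wE antipoder w1 scale1r.
  by rewrite mul1r.
move/(congr1 phi); rewrite phih linear_sum big1 => [/eqP|i _]; last exact: phi_u.
by rewrite oner_eq0.
Qed.
End HopfIdeals.

(** * The canonical map and the image of the separability idempotent *)

Section SeparableGalois.
Variables (k : fieldType) (H : hopfAlgType k) (A : comodAlgType H).

Lemma can_lact (a : A) (e : tensor_over (@coinv k H A)) :
  can (lact a e) = (a ⊗ 1) * can e.
Proof.
elim/btensor_ind: e => [s t IHs IHt|x y].
  by rewrite lact_zmod !can_zmod IHs IHt mulrBr.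
by rewrite lactE !canE !tmap_mull mulrA pureM mulr1.
Qed.

(** Multiplicativity of the coaction turns the right action into multiplication by ρ(a); with
    [can_lact], centrality of the idempotent becomes (a ⊗ 1) t = t ρ(a). *)
Lemma can_ract (a : A) (e : tensor_over (@coinv k H A)) :
  can (ract e a) = can e * coact a.
Proof.
elim/btensor_ind: e => [s t IHs IHt|x y].
  by rewrite ract_zmod !can_zmod IHs IHt mulrBl.
rewrite ractE !canE !tmap_mull -mulrA.
by rewrite (coact_monoid_morphism (s := A)).2.
Qed.

(** Following [can] by id ⊗ ε gives multiplication, so the normalization of the idempotent becomes
    (id ⊗ ε) t = 1. *)
Lemma can_counit (x y : A) :
  tlift (fun (a : A) (h : H) => (counit h : k) *: a) (can (pure_over (@coinv k H A) x y)) = x * y.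
Proof.
rewrite canE tmap_mull -[in RHS](coact_counit y) (legsE (coact y)) mulr_sumr.
rewrite !(zmod_morphism_sum _ _ (tliftB (@balanced_counit k H A))) mulr_sumr.
apply: eq_bigr => p _; rewrite pureM !tliftE; try exact: balanced_counit.
by rewrite mul1r scalerAr.
Qed.

(** By coassociativity the sum is y_0 ⊗ y_1 S(y_2), which reduces to y_0 ε(y_1) ⊗ 1. *)
Lemma coact_antipode_sum (y : A) :
  \sum_(p <- legs (coact y)) coact p.1 * (1 ⊗ antipode p.2) = y ⊗ 1 :> (A ⊗ H)%type.
Proof.
transitivity (\sum_(p <- legs (coact y)) \sum_(q <- legs (coact p.1))
    q.1 ⊗ (q.2 * antipode p.2) : (A ⊗ H)%type).
  apply: eq_bigr => p _; rewrite [in LHS](legsE (coact p.1)) mulr_suml.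
  by apply: eq_bigr => q _; rewrite pureM mulr1.
rewrite (@coassoc_sum _ _ _ _ _ (fun (a : A) (b c : H) => a ⊗ (b * antipode c))).
- rewrite -[in RHS](coact_counit y) tlift_legs; last exact: balanced_counit.
  rewrite pure_suml; apply: eq_bigr => p _.
  by rewrite pureZlr -antipoder_sum pure_sumr.
- exact: coactA.
- split=> x; split=> *; rewrite ?raddfD ?(mulrDl, mulrDr, pureDl, pureDr) //=.
    by rewrite -scalerAl pureZlr.
  by rewrite linearZ /= -scalerAr -scalerAl.
Qed.

Variable t : (A ⊗ H)%type.
Hypothesis t_central : forall a : A, (a ⊗ 1) * t = t * coact a.

Let pure_mulZ c (a : A) s : ((c *: a) ⊗ 1) * s = (a ⊗ 1) * (c *: s) :> (A ⊗ H)%type.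
Proof.
rewrite [s]legsE scaler_sumr !mulr_sumr; apply: eq_bigr => p _.
by rewrite -pureZr !pureM mul1r -scalerAl pureZlr mul1r.
Qed.

Let pure_mulZr c (h : H) s : s * (1 ⊗ (c *: h)) = (c *: s) * (1 ⊗ h) :> (A ⊗ H)%type.
Proof.
rewrite [s]legsE scaler_sumr !mulr_suml; apply: eq_bigr => p _.
by rewrite -pureZl !pureM mulr1 -scalerAr -pureZlr mulr1.
Qed.

Let conj_t := tlift (fun (a : A) (h : H) => (a ⊗ 1) * (t * (1 ⊗ antipode h)) : (A ⊗ H)%type).

Let conj_t_balanced :
  tbalanced (fun (a : A) (h : H) => (a ⊗ 1) * (t * (1 ⊗ antipode h)) : (A ⊗ H)%type).
Proof.
split=> *; rewrite ?raddfD ?(pureDl, pureDr) ?(mulrDl, mulrDr) //=.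
rewrite linearZ /= pure_mulZr pure_mulZ; congr (_ * _).
by rewrite [t]legsE scaler_sumr !mulr_suml scaler_sumr; apply: eq_bigr => p _;
  rewrite -pureZl !pureM -pureZl !mulr1.
Qed.

(* [conj_t (can (x ⊗ y)) = (x ⊗ 1) t coact(y_0) (1 ⊗ S(y_1)) = (x ⊗ 1) t (y ⊗ 1)];
   evaluate at the preimage of [1 ⊗ h] under [can]. *)
Lemma galois_mul_antipode (h : H) : hopf_galois A ->
  exists r : seq (A * A), t * (1 ⊗ antipode h) = \sum_(p <- r) (p.1 ⊗ 1) * t * (p.2 ⊗ 1).
Proof.
case=> canV _ canVK.
have conjB : zmod_morphism conj_t by exact: tliftB.
have conjE (e : tensor_over (@coinv k H A)) : exists r : seq (A * A),
    conj_t (can e) = \sum_(p <- r) (p.1 ⊗ 1) * t * (p.2 ⊗ 1).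
  elim/btensor_ind: e => [e1 e2 [r Er] [s Es]|x y].
    exists (r ++ [seq (- p.1, p.2) | p <- s]).
    rewrite can_zmod conjB Er Es big_cat big_map.
    rewrite -sumrN /=; congr (_ + _); apply: eq_bigr => p _.
    by rewrite -[- p.1]scaleN1r pureZl scaleN1r !mulNr.
  exists [:: (x, y)]; rewrite big_seq1 canE tmap_mull /=.
  rewrite (legsE (coact y)) mulr_sumr (zmod_morphism_sum _ _ conjB).
  rewrite -[y ⊗ 1]coact_antipode_sum !mulr_sumr; apply: eq_bigr => p _.
  rewrite pureM mul1r /conj_t tliftE // !mulrA -[_ * t * coact _]mulrA -t_central !mulrA.
  by rewrite pureM mulr1.
have [r] := conjE (canV (1 ⊗ h)); rewrite canVK => rE; exists r; rewrite -rE.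
by rewrite /conj_t tliftE // mul1r.
Qed.

End SeparableGalois.

(** * The right ideal of [H] cut out by the separability idempotent *)

Theorem mainTheorem1 (k : fieldType) (H : hopfAlgType k) (A : comodAlgType H)
    (galois_A : hopf_galois A) (separable_A : separable_over (@coinv k H A)) :
  finite_dimensional H.
Proof.
have [e [e1 e_central]] := separable_A.
set t0 : tensor_over _ := \sum_(p <- e) _ in e_central.
pose t := can t0.
have t_central a : (a ⊗ 1) * t = t * coact a.
  by rewrite -can_lact e_central can_ract.
(* Since 1 is nonzero in [A], a functional separates it from the zero subspace. *)
have [//|//|phi [_ phi1]] := @separating_functional k A (fun x => x = 0) 1.
- by split=> // c x y -> ->; rewrite scaler0 addr0.
- by apply/eqP; rewrite oner_eq0.
have phiZ c a : (phi (c *: a) : k) = c * (phi a : k) by rewrite linearZ.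
have bphi : tbalanced (fun (a : A) (h : H) => (phi a : k) *: h).
  split=> *; rewrite ?raddfD ?(scalerDl, scalerDr) //=.
  by rewrite phiZ scalerA mulrC.
pose F := tlift (fun (a : A) (h : H) => (phi a : k) *: h).
have FB : zmod_morphism F by exact: tliftB.
have FD : {morph F : s s' / s + s'} by exact: tliftD.
have FM s (h : H) : F (s * (1 ⊗ h)) = F s * h.
  rewrite [s]legsE mulr_suml !(zmod_morphism_sum _ _ FB) mulr_suml.
  by apply: eq_bigr => p _; rewrite pureM /F !tliftE // mulr1 scalerAl.
pose conj r : (A ⊗ H)%type := \sum_(p <- r : seq (A * A)) (p.1 ⊗ 1) * t * (p.2 ⊗ 1).
pose N y := exists r, y = F (conj r).
have subN : subspace N.
  split=> [|c _ _ [r ->] [s ->]].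
    by exists [::]; rewrite /conj big_nil; have := FB 0 0; rewrite !subrr => ->.
  exists ([seq (c *: p.1, p.2) | p <- r] ++ s).
  rewrite /conj big_cat big_map /= FD; congr (_ + _).
  rewrite !(zmod_morphism_sum _ _ FB) scaler_sumr; apply: eq_bigr => p _.
  rewrite [t]legsE !(mulr_sumr, mulr_suml) !(zmod_morphism_sum _ _ FB) scaler_sumr.
  apply: eq_bigr => q _.
  by rewrite !pureM /F !tliftE // -!scalerAl phiZ -scalerA.
have finN : finspanned N.
  (* The factors x ⊗ 1 and y ⊗ 1 change only the [A]-legs of [t]. *)
  pose S := [seq p.2 | p <- legs t]; exists S => _ [r ->].
  rewrite (zmod_morphism_sum _ _ FB); apply: (subspace_sum (linear_span_subspace _)) => p.
  rewrite [t]legsE mulr_sumr mulr_suml (zmod_morphism_sum _ _ FB).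
  apply: (subspace_sum_seq (linear_span_subspace _)) => q tq.
  rewrite !pureM /F tliftE // mul1r mulr1.
  by apply: (subspaceZ (linear_span_subspace _)); apply: mem_linear_span; exact: (map_f snd).
have NS y h : N y -> N (y * antipode h).
  case=> r ->; have [s sE] := galois_mul_antipode t_central h galois_A.
  (* 1 ⊗ S(h) commutes with p.2 ⊗ 1, so it can be moved next to [t] and expanded there; the
     right-hand factors therefore nest in reverse order. *)
  exists [seq (p.1 * q.1, q.2 * p.2) | p <- r, q <- s].
  rewrite -FM; congr F; rewrite /conj big_allpairs_dep mulr_suml.
  apply: eq_bigr => p _ /=.
  transitivity ((p.1 ⊗ 1) * (t * (1 ⊗ antipode h)) * (p.2 ⊗ 1)).
    by rewrite -!mulrA !pureM !(mul1r, mulr1).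
  rewrite sE mulr_sumr mulr_suml; apply: eq_bigr => q _.
  by rewrite !mulrA pureM mulr1 -[LHS]mulrA pureM mulr1.
apply: (ideal_finite_dimensional (w := F t) finN
  (stable_by_antipode_ideal subN finN NS)).
  by exists [:: (1, 1)]; rewrite /conj big_seq1 /= -pure1 mul1r mulr1.
(* ε(F t) = phi((id ⊗ ε) t) = phi(Σ e_i e'_i) = phi(1) = 1. *)
rewrite -phi1 -e1 -(eq_bigr _ (fun p _ => can_counit p.1 p.2)).
rewrite -(zmod_morphism_sum _ _ (tliftB (@balanced_counit k H A))).
rewrite -(zmod_morphism_sum _ _ (@can_zmod k H A)) -/t0 -/t.
rewrite [t]legsE (zmod_morphism_sum _ _ FB) tlift_sum; last exact: balanced_counit.
rewrite !raddf_sum; apply: eq_bigr => p _; rewrite /F tliftE //.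
transitivity ((phi p.1 : k) * (counit p.2 : k)); first exact: counitZ.
by rewrite mulrC; symmetry; exact: phiZ.
Qed.
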